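(* Let $X$ be a complex Banach space and let $S$ be a bounded scalar type operator on $X$ with spectral resolution $\mathcal{E}$ and with spectral radius greater than $0$. Let $z\in\mathbb{C}$ satisfy $|z|=\sup_{\lambda\in\mathrm{Sp}(S)}|\lambda|$. Then $$ \lim_{n\rightarrow\infty} \frac{1}{n}\sum_{k=1}^n z^{-k} S^k x=\mathcal{E}(\{z\})x\qquad \text{for all } x\in X, $$ where the limit is taken in the norm of $X$.
   Context: $\mathrm{Sp}(T)$ denotes the spectrum of a bounded operator $T$, and $B(\mathbb{C})$ denotes the Borel subsets of $\mathbb{C}$. A bounded and countably additive spectral measure in $X$ is a map $\mathcal{E}$ from $B(\mathbb{C})$ to the set of bounded (not necessarily orthogonal) projections in $X$ such that: (i) $\mathcal{E}(\emptyset)=0$ and $\mathcal{E}(\mathbb{C})=I$; (ii) $\mathcal{E}(E_1\cap E_2)=\mathcal{E}(E_1)\mathcal{E}(E_2)$ and $\mathcal{E}(\mathbb{C}\setminus E)=I-\mathcal{E}(E)$ for all $E,E_1,E_2\in B(\mathbb{C})$; (iii) $\sup_{E\in B(\mathbb{C})}\|\mathcal{E}(E)\|<\infty$; (iv) if $\{E_j\}_{j\ge 1}\subset B(\mathbb{C})$ are disjoint and $x\in X$, then $\mathcal{E}(\bigcup_{j=1}^\infty E_j)x=\sum_{j=1}^\infty \mathcal{E}(E_j)x$, with convergence in $X$. Such an $\mathcal{E}$ is called a resolution of the identity (or spectral resolution) for a bounded operator $T$ on $X$ if, for every $E\in B(\mathbb{C})$, $\mathcal{E}(E)T=T\mathcal{E}(E)$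 and the spectrum of the restriction of $T$ to the closed invariant subspace $\mathcal{E}(E)X$ is contained in the closure of $E$. If such an $\mathcal{E}$ exists, $T$ is called a spectral operator. A bounded operator $S$ on $X$ is a scalar type operator with spectral resolution $\mathcal{E}$ if $\mathcal{E}$ is a spectral resolution for $S$ and $S=\int \lambda \,\mathrm{d}\mathcal{E}(\lambda)$, where integrals of bounded Borel functions against $\mathcal{E}$ are defined as limits in operator norm of integrals of simple functions (uniform approximation), the integral being over $\mathrm{Sp}(S)$, on which $\mathcal{E}$ is supported. *)

(* Defs.v *)
From HB Require Import structures.
From mathcomp Require Import all_boot all_order all_algebra.
From mathcomp Require Import all_classical all_reals all_analysis.
From mathcomp Require Import complex.

Set Implicit Arguments.
Unset Strict Implicit.
Unset Printing Implicit Defensive.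

Import Order.TTheory GRing.Theory Num.Theory.
Import numFieldNormedType.Exports.

Local Open Scope classical_set_scope.
Local Open Scope ring_scope.
Local Open Scope complex_scope.

(* The usual topology and uniformity of the complex plane. *)
HB.instance Definition _ (R : rcfType) :=
  PseudoPointedMetric.copy R[i] (R[i] : numClosedFieldType).

(* A complex Banach space is a [completeNormedModType R[i]].  Its norm takes
   its values in [R[i]]; these are nonnegative reals, of which [rnorm] is the
   underlying element of [R]. *)
Definition rnorm (R : realType) (V : normedZmodType R[i]) (x : V) : R :=
  complex.Re `|x|.

Definition borel (R : realType) : set_system R[i] :=
  <<s [set A : set R[i] | open A] >>.

Section Operators.
Variables (R : realType) (X : completeNormedModType R[i]).
Implicit Types (Y : set X) (T U : X -> X).

Definition bounded_on Y T : Prop :=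
  exists M : R, forall y, Y y -> rnorm (T y) <= M * rnorm y.

Definition bounded_operator T : Prop := linear T /\ bounded_on setT T.

(* Meaningful for bounded operators only: the supremum of an unbounded set
   is 0. *)
Definition opnorm T : R := sup [set rnorm (T x) | x in [set x | rnorm x <= 1]].

Definition linear_on Y T : Prop :=
  forall (a : R[i]) u v, Y u -> Y v -> T (a *: u + v) = a *: T u + T v.

(* [l] belongs to the resolvent set of the restriction of [T] to the invariant
   subspace [Y]: the map [T - l I] of [Y] has a bounded linear inverse [U]
   on [Y].  Values of [U] outside [Y] are irrelevant. *)
Definition resolvent_on Y T : set R[i] := [set l | exists U,
  [/\ forall y, Y y -> Y (U y), linear_on Y U, bounded_on Y U,
      forall y, Y y -> U (T y - l *: y) = y &
      forall y, Y y -> T (U y) - l *: U y = y]].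

Definition spectrum_on Y T : set R[i] := ~` resolvent_on Y T.

Definition spectrum T : set R[i] := spectrum_on setT T.

Definition spectral_radius T : R := sup [set rnorm l | l in spectrum T].

(* Only the values of [P] on Borel sets matter. *)
Record spectral_measure (P : set R[i] -> X -> X) : Prop := SpectralMeasure {
  spectral_measure_bounded : forall A, borel A -> bounded_operator (P A) ;
  spectral_measure_proj : forall A, borel A -> P A \o P A = P A ;
  spectral_measure0 : P set0 = cst 0 ;
  spectral_measureT : P setT = id ;
  spectral_measureI : forall A B, borel A -> borel B ->
    P (A `&` B) = P A \o P B ;
  spectral_measureC : forall A, borel A -> P (~` A) = id \- P A ;
  spectral_measure_unif : has_ubound [set opnorm (P A) | A in @borel R] ;
  spectral_measure_sigma_additive : forall (A : (set R[i])^nat) (x : X),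
    (forall j, borel (A j)) -> trivIset setT A ->
    series (fun j => P (A j) x) @ \oo --> P (\bigcup_j A j) x }.

Definition resolution_of_identity (P : set R[i] -> X -> X) T : Prop :=
  [/\ spectral_measure P,
      forall A, borel A -> P A \o T = T \o P A &
      forall A, borel A -> spectrum_on (range (P A)) T `<=` closure A].

Definition simple_function (s : R[i] -> R[i]) : Prop :=
  finite_set (range s) /\ forall v, borel (s @^-1` [set v]).

Definition simple_integral (P : set R[i] -> X -> X) (D : set R[i])
    (s : R[i] -> R[i]) : X -> X :=
  fun x => \sum_(v \in range s) (v *: P (D `&` s @^-1` [set v]) x).

(* [T] is the integral of [f] over [D] against [P]: a limit in operator norm
   of integrals of simple functions converging to [f] uniformly on [D]. *)
Definition is_spectral_integral (P : set R[i] -> X -> X) (D : set R[i])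
    (f : R[i] -> R[i]) T : Prop :=
  exists s : nat -> R[i] -> R[i],
    [/\ forall n, simple_function (s n),
        {uniform D, s @ \oo --> f} &
        (fun n => opnorm (simple_integral P D (s n) \- T)) @ \oo --> (0 : R)].

Definition scalar_type (P : set R[i] -> X -> X) T : Prop :=
  [/\ bounded_operator T, resolution_of_identity P T &
      is_spectral_integral P (spectrum T) id T].

End Operators.

(* Main.v *)
Require Import Defs.
From HB Require Import structures.
From mathcomp Require Import all_boot all_order all_algebra.
From mathcomp Require Import all_classical all_reals all_analysis.
From mathcomp Require Import complex.
From mathcomp Require Import ring lra.

Set Implicit Arguments.
Unset Strict Implicit.
Unset Printing Implicit Defensive.

Import Order.TTheory GRing.Theory Num.Theory.
Import numFieldNormedType.Exports.

Local Open Scope classical_set_scope.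
Local Open Scope ring_scope.
Local Open Scope complex_scope.

(** Write [r = |z|], which is the spectral radius, and let [M n x] be the
    average [1/n * sum_(1 <= k <= n) z^-k S^k x].  The theorem is a mean
    ergodic theorem for [S / z], and it rests on four facts.

    - [S / z] is power bounded: [|S^k x| <= C r^k |x|]
      ([scalar_type_power_bounded]).  Indeed [S^k] is the limit of the [k]-th
      powers of simple integrals [\int s dE], these powers are the integrals
      [\int s^k dE], and the integral of a simple function bounded by [m] has
      norm at most a constant times [m] ([rnorm_simple_sum]).  Hence the averages
      are bounded uniformly in [n] ([rnorm_ergodic_average]).
    - On the range of [E {z}], [S] acts as [z] ([scalar_type_eigen]), so the
      averages fix [E {z} x].
    - Let [A_N] be the set of [l] at distance at least [1/(N+1)] from [z].  Since
      [z] is not in the closure of [A_N], [S - z] is invertible on the range of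
      [E A_N], so that [E A_N x] has the form [S u - z u]; on such a vector the
      averages telescope and tend to [0] ([ergodic_average_coboundary]).
    - The sets [A_N] increase to the complement of [z], so by countable
      additivity [E A_N x] tends to [x - E {z} x] ([spectral_measure_cvg]).

    Splitting [x = E {z} x + E A_N x + w] with [w] small gives the limit.

    The integral defining [S] is taken over the spectrum, and says something
    about [S] only if the spectrum is a Borel set.  It is closed, because the
    resolvent set is open ([open_resolvent]); this is where the completeness of
    the space enters. *)

(** * Real-valued norms *)

Section RealNorm.
Context (R : realType).

Section Normed.
Context (V : normedZmodType R[i]).
Implicit Types x y : V.

Lemma rnormE x : `|x| = (rnorm x)%:C.
Proof. by rewrite /rnorm RRe_real // normr_real. Qed.

Lemma rnorm_ge0 x : 0 <= rnorm x.
Proof. by rewrite -ler0c -rnormE normr_ge0. Qed.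

Lemma rnorm0 : rnorm (0 : V) = 0.
Proof. by rewrite /rnorm normr0. Qed.

Lemma rnorm_eq0 x : rnorm x = 0 -> x = 0.
Proof. by move=> x0; apply/normr0_eq0; rewrite rnormE x0. Qed.

Lemma rnorm_gt0 x : (0 < rnorm x) = (x != 0).
Proof. by rewrite -ltcR -rnormE normr_gt0. Qed.

Lemma rnormN x : rnorm (- x) = rnorm x.
Proof. by rewrite /rnorm normrN. Qed.

Lemma ler_rnormD x y : rnorm (x + y) <= rnorm x + rnorm y.
Proof. by rewrite -lecR rmorphD /= -!rnormE ler_normD. Qed.

Lemma ler_rnormB x y : rnorm (x - y) <= rnorm x + rnorm y.
Proof. by rewrite -(rnormN y) ler_rnormD. Qed.

Lemma rdistC x y : rnorm (x - y) = rnorm (y - x).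
Proof. by rewrite -rnormN opprB. Qed.

Lemma ler_rdistD z x y : rnorm (x - y) <= rnorm (x - z) + rnorm (z - y).
Proof. by rewrite (le_trans _ (ler_rnormD _ _))// addrA subrK. Qed.

Lemma ler_rnorm_sum (I : Type) (s : seq I) (F : I -> V) :
  rnorm (\sum_(i <- s) F i) <= \sum_(i <- s) rnorm (F i).
Proof.
elim/big_rec2: _ => [|i m y _ IH]; first by rewrite rnorm0.
by rewrite (le_trans (ler_rnormD _ _))// lerD2l.
Qed.

End Normed.

Section NormedModule.
Context (V : normedModType R[i]).

Lemma rnormZ (a : R[i]) (x : V) : rnorm (a *: x) = rnorm a * rnorm x.
Proof.
by apply: complexI; rewrite rmorphM/= -!rnormE normrZ.
Qed.

Lemma cvg_rnormP (u : nat -> V) (l : V) :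
  u @ \oo --> l <->
  forall e : R, 0 < e -> \forall n \near \oo, rnorm (l - u n) < e.
Proof.
split=> [/cvgrPdist_lt ul e e0|ul].
  have := ul e%:C; rewrite ltcR => /(_ e0).
  by apply: filterS => n; rewrite rnormE ltcR.
apply/cvgrPdist_lt => e; rewrite ltcE => /andP[/eqP Ime Ree].
have -> : e = (complex.Re e)%:C by rewrite [LHS]complexE Ime mulr0 addr0.
by apply: filterS (ul _ Ree) => n; rewrite rnormE ltcR.
Qed.

End NormedModule.

Implicit Types a b : R[i].

Lemma crnormM a b : rnorm (a * b) = rnorm a * rnorm b.
Proof. by apply: complexI; rewrite rmorphM/= -!rnormE normrM. Qed.

Lemma crnormX a n : rnorm (a ^+ n) = rnorm a ^+ n.
Proof. by apply: complexI; rewrite rmorphXn/= -!rnormE normrX. Qed.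

Lemma crnormV a : rnorm a^-1 = (rnorm a)^-1.
Proof. by apply: complexI; rewrite fmorphV/= -!rnormE normfV. Qed.

Lemma crnorm_nat n : rnorm (n%:R : R[i]) = n%:R.
Proof. by apply: complexI; rewrite rmorph_nat -rnormE normr_nat. Qed.

Lemma crnorm_real (r : R) : rnorm r%:C = `|r|.
Proof.
by apply: complexI; rewrite -rnormE normc_def/= expr0n addr0 sqrtr_sqr.
Qed.

Lemma normRe_le a : `|complex.Re a| <= rnorm a.
Proof. by rewrite -lecR -rnormE normc_ge_Re. Qed.

Lemma rnorm_i : rnorm ('i : R[i]) = 1.
Proof.
by apply: complexI; rewrite -rnormE normc_def/= expr0n/= add0r expr1n sqrtr1.
Qed.

Lemma normIm_le a : `|complex.Im a| <= rnorm a.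
Proof.
have := normRe_le (a * 'i); rewrite ReiNIm normrN crnormM.
by rewrite rnorm_i mulr1.
Qed.

Lemma open_rnormP (A : set R[i]) :
  (forall a, A a -> exists2 r : R, 0 < r &
    forall b, rnorm (a - b) < r -> A b) ->
  open A.
Proof.
move=> HA; rewrite openE => a /HA[r r0 ar].
apply/nbhs_ballP; exists r%:C; first by rewrite /= ltcR.
by move=> b; rewrite /ball/= rnormE ltcR => /ar.
Qed.

Lemma not_closure_rnorm (A : set R[i]) a (r : R) : 0 < r ->
  (forall b, A b -> r <= rnorm (a - b)) -> ~ closure A a.
Proof.
move=> r0 HA /(_ (ball a r%:C)) [|b [/HA + ]].
  by apply: nbhsx_ballx; rewrite ltcR.
by rewrite /ball/= rnormE ltcR leNgt => /negP.
Qed.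

Lemma uniform_cvg_rnorm (D : set R[i]) (s : nat -> R[i] -> R[i]) f :
  {uniform D, s @ \oo --> f} -> forall e : R, 0 < e ->
  \forall n \near \oo, forall v, D v -> rnorm (f v - s n v) < e.
Proof.
move=> sf e e0.
apply: (sf [set h | forall v, D v -> rnorm (f v - h v) < e]).
apply/uniform_nbhs.
exists [set p : R[i] * R[i] | ball p.1 e%:C p.2]; split.
  by rewrite -entourage_from_ballE; exists e%:C => //=; rewrite ltcR.
by move=> h /= Hh v /Hh; rewrite /ball/= rnormE ltcR.
Qed.

End RealNorm.

(** * Open resolvent sets and Borel spectra *)

Section Resolvent.
Context (R : realType) (X : completeNormedModType R[i]).
Implicit Types (Y : set X) (T U : X -> X) (x y : X).

Lemma bounded_on_pos Y T : bounded_on Y T ->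
  exists2 M : R, 0 < M & forall y, Y y -> rnorm (T y) <= M * rnorm y.
Proof.
move=> [M TM]; exists (`|M| + 1); first by rewrite ltr_wpDl.
move=> y /TM /le_trans; apply; rewrite ler_wpM2r ?rnorm_ge0//.
by rewrite (le_trans (ler_norm M))// lerDl.
Qed.

(** The iterates of [0] form a Cauchy sequence, and its limit is fixed: this is
    Banach's theorem with ratio [1/2], for a norm with values in [R[i]]. *)
Lemma contraction_fixpoint (F : X -> X) :
  (forall x y, rnorm (F x - F y) <= 2^-1 * rnorm (x - y)) ->
  exists p, F p = p.
Proof.
move=> Fc.
have Fn n x y : rnorm (iter n F x - iter n F y) <= 2^-1 ^+ n * rnorm (x - y).
  elim: n => [|n IH]; first by rewrite expr0 mul1r.
  by rewrite !iterS (le_trans (Fc _ _))// exprS -mulrA ler_pM2l.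
(* Summing the geometric series, all iterates of 0 stay within 2 C of 0. *)
pose C := rnorm (F 0).
have Fbnd n : rnorm (iter n F 0) <= 2 * C.
  elim: n => [|n IH]; first by rewrite rnorm0 mulr_ge0 ?rnorm_ge0.
  rewrite iterS -(subrK (F 0) (F _)) (le_trans (ler_rnormD _ _))//.
  have := Fc (iter n F 0) 0; rewrite subr0 => H.
  by rewrite (le_trans (lerD H (lexx _)))// -/C; lra.
have small (e : R) : 0 < e -> \forall n \near \oo, 2^-1 ^+ n * (2 * C) < e.
  move=> e0.
  have /cvgrPdist_lt/(_ e e0) :
      (fun n => 2^-1 ^+ n * (2 * C)) @ \oo --> (0 : R).
    rewrite -(mul0r (2 * C)); apply: cvgMl; apply: cvg_expr.
    by rewrite ger0_norm// invf_lt1// ltr1n.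
  apply: filterS => n; rewrite sub0r normrN; apply: le_lt_trans.
  exact: ler_norm.
pose u n := iter n F 0.
have cu : cvg (u @ \oo).
  apply/cauchy_cvgP/cauchyP => e; rewrite ltcE => /andP[/eqP Ime Ree].
  have [N _ HN] := small _ Ree.
  exists (u N); exists N => // n /= Nn.
  rewrite -ball_normE /= rnormE ltcE Ime eqxx /=.
  apply: le_lt_trans (HN N (leqnn N)); rewrite rdistC /u -(subnKC Nn) iterD.
  apply: le_trans (Fn N _ _) _; rewrite subr0.
  by rewrite ler_wpM2l.
have [p up] := (cvg_ex _).1 cu.
exists p; apply/eqP; rewrite -subr_eq0; apply/eqP/rnorm_eq0/eqP.
rewrite eq_le rnorm_ge0 andbT; apply/ler_addgt0Pl => e e0; rewrite addr0.
have [N _ HN] := (cvg_rnormP _ _).1 up _ (divr_gt0 e0 (ltr0n _ 2)).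
have H1 := HN N (leqnn N); have H2 := HN N.+1 (leqnSn N).
have H3 := Fc p (u N); have H4 := ler_rdistD (u N.+1) (F p) p.
have H5 := rdistC (u N.+1) p.
have -> : e = e / 2 + e / 2 by lra.
rewrite (le_trans H4)// H5 lerD ?(ltW H2)// (le_trans H3)//.
by move: H1 (rnorm_ge0 (p - u N)) => /=; lra.
Qed.

(** Writing [U] for the inverse of [T - l], the equation [T x - m x = y] reads
    [x = U (y + (m - l) x)], and the right-hand side is a contraction in [x]
    when [m] is close to [l]. *)
Lemma open_resolvent T : open (resolvent_on setT T).
Proof.
apply: open_rnormP => l [U [_ Ulin /bounded_on_pos[M M0 UM] UT TU]].
have UB u v : U (u - v) = U u - U v.
  by rewrite addrC -scaleN1r Ulin// scaleN1r addrC.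
exists (2 * M)^-1 => [|m lm]; first by rewrite invr_gt0 mulr_gt0.
pose d := m - l.
have dM : rnorm d * M <= 2^-1.
  by rewrite -ler_pdivlMr// -invfM ltW// /d rdistC.
have Fc y x x' : rnorm (U (y + d *: x) - U (y + d *: x')) <=
    2^-1 * rnorm (x - x').
  rewrite -UB opprD addrACA subrr add0r -scalerBr.
  rewrite (le_trans (UM _ I))// rnormZ mulrA ler_wpM2r ?rnorm_ge0//.
  by rewrite mulrC.
(* Fixed points of this contraction are unique, which gives linearity and the
   left inverse property of the new inverse. *)
have uniq y x x' : U (y + d *: x) = x -> U (y + d *: x') = x' -> x = x'.
  move=> ex ex'; have := Fc y x x'; rewrite ex ex' => H.
  apply/eqP; rewrite -subr_eq0; apply/eqP/rnorm_eq0.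
  by move: H (rnorm_ge0 (x - x')); lra.
have /choice[G GE] y := contraction_fixpoint (Fc y).
exists G; split => //.
- move=> a u v _ _; apply: uniq (GE _) _.
  rewrite scalerDr addrACA scalerA mulrC -scalerA -scalerDr Ulin//.
  by rewrite !GE.
- exists (2 * M) => y _.
  have := ler_rdistD (U y) (G y) 0; rewrite !subr0.
  have := Fc y (G y) 0; rewrite GE scaler0 addr0 subr0.
  by have := UM y I; lra.
- move=> y _; apply: uniq (GE _) _.
  rewrite -[RHS](UT _ I); congr U; rewrite -addrA; congr (_ + _).
  by rewrite scalerBl addrA addNr add0r.
- move=> y _; have := TU (y + d *: G y) I; rewrite GE => E.
  have -> : m = l + d by rewrite /d addrC subrK.
  by rewrite scalerDl opprD addrA E addrK.
Qed.

Lemma borel_open (A : set R[i]) : open A -> borel A.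
Proof. exact: sub_sigma_algebra. Qed.

Lemma borelC (A : set R[i]) : borel A -> borel (~` A).
Proof. by rewrite -setTD; exact: sigma_algebraCD. Qed.

Lemma borel0 : borel (set0 : set R[i]).
Proof. by apply: borel_open; exact: open0. Qed.

Lemma borelU (A B : set R[i]) : borel A -> borel B -> borel (A `|` B).
Proof.
move=> bA bB; rewrite -bigcup2E; apply: sigma_algebra_bigcup => -[|[|n]] //=.
exact: borel0.
Qed.

Lemma borelI (A B : set R[i]) : borel A -> borel B -> borel (A `&` B).
Proof.
move=> bA bB; rewrite -[X in borel X]setCK setCI.
by apply: borelC; apply: borelU; exact: borelC.
Qed.

Lemma borelD (A B : set R[i]) : borel A -> borel B -> borel (A `\` B).
Proof. by move=> bA bB; rewrite setDE; apply: borelI => //; exact: borelC. Qed.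

Lemma borel_spectrum T : borel (spectrum T).
Proof. by apply: borelC; apply: borel_open; exact: open_resolvent. Qed.

Lemma borel_far (z : R[i]) (r : R) : borel [set l | r <= rnorm (z - l)].
Proof.
rewrite -[X in borel X]setCK.
apply: borelC; apply: borel_open; apply: open_rnormP => a /=.
move=> /negP; rewrite -ltNge => za; exists (r - rnorm (z - a)).
  by rewrite subr_gt0.
move=> b ab; apply/negP; rewrite -ltNge.
by have := ler_rdistD a z b; lra.
Qed.

Lemma borel_set1 (z : R[i]) : borel [set z].
Proof.
rewrite -[X in borel X]setCK.
apply: borelC; apply: borel_open; apply: open_rnormP => a /= az.
exists (rnorm (a - z)); first by rewrite rnorm_gt0 subr_eq0; apply/eqP.
by move=> b ab eb; move: ab; rewrite eb ltxx.
Qed.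

End Resolvent.

(** * Spectral measures *)

Section LinearMaps.
Context (K : nzRingType) (V W : lmodType K) (T : V -> W) (Tlin : linear T).

Let T' : {linear V -> W} := HB.pack T (GRing.isLinear.Build _ _ _ _ T Tlin).

Lemma linear_fun0 : T 0 = 0.
Proof. exact: (linear0 T'). Qed.

Lemma linear_funD x y : T (x + y) = T x + T y.
Proof. exact: (linearD T'). Qed.

Lemma linear_funB x y : T (x - y) = T x - T y.
Proof. exact: (linearB T'). Qed.

Lemma linear_funZ a x : T (a *: x) = a *: T x.
Proof. exact: (linearZ_LR T'). Qed.

Lemma linear_fun_sum (I : Type) (s : seq I) (F : I -> V) :
  T (\sum_(i <- s) F i) = \sum_(i <- s) T (F i).
Proof. exact: (linear_sum T'). Qed.

End LinearMaps.

Section OperatorNorm.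
Context (R : realType) (X : completeNormedModType R[i]).
Implicit Types (T U : X -> X) (x y : X).

Lemma bounded_operator_pos T : bounded_operator T ->
  exists2 M : R, 0 < M & forall x, rnorm (T x) <= M * rnorm x.
Proof. by move=> [_ /bounded_on_pos[M M0 TM]]; exists M => // x; exact: TM. Qed.

(** For a bounded operator the supremum defining [opnorm T] is over a set that
    is bounded above, and [x] is a scalar multiple of a unit vector. *)
Lemma ler_opnorm T x : bounded_operator T -> rnorm (T x) <= opnorm T * rnorm x.
Proof.
move=> /[dup] -[Tlin _] /bounded_operator_pos[M M0 TM].
have [->|x0] := eqVneq x 0; first by rewrite (linear_fun0 Tlin) !rnorm0 mulr0.
have rx : 0 < rnorm x by rewrite rnorm_gt0.
pose y := (rnorm x)^-1%:C *: x.
have xE : x = (rnorm x)%:C *: y.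
  by rewrite /y scalerA -rmorphM divff ?gt_eqF// rmorph1 scale1r.
have y1 : rnorm y <= 1.
  rewrite rnormZ crnorm_real ger0_norm ?invr_ge0 ?rnorm_ge0//.
  by rewrite mulVf ?gt_eqF.
rewrite [in T x]xE (linear_funZ Tlin) rnormZ crnorm_real ger0_norm ?rnorm_ge0//.
rewrite mulrC ler_pM2r//; apply: ub_le_sup; last by exists y.
exists M => _ [u /= u1 <-]; rewrite (le_trans (TM u))//.
by rewrite -[leRHS]mulr1 ler_pM2l.
Qed.

Lemma bounded_operatorB T U : bounded_operator T -> bounded_operator U ->
  bounded_operator (T \- U).
Proof.
move=> /[dup] -[Tlin _] /bounded_operator_pos[M M0 TM].
move=> /[dup] -[Ulin _] /bounded_operator_pos[N N0 UN].
split=> [a x y|]; first by rewrite /= Tlin Ulin scalerBr addrACA opprD.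
exists (M + N) => x _ /=; rewrite (le_trans (ler_rnormB _ _))// mulrDl.
by rewrite lerD.
Qed.

(** Induction on [k] with the splitting
    [Tn^(k+1) x - T^(k+1) x = (Tn - T) (Tn^k x) + T (Tn^k x - T^k x)],
    where [Tn^k x] stays bounded as it converges. *)
Lemma cvg_iter_opnorm (Tn : nat -> X -> X) T k x :
  bounded_operator T -> (forall n, bounded_operator (Tn n)) ->
  (fun n => opnorm (Tn n \- T)) @ \oo --> (0 : R) ->
  (fun n => iter k (Tn n) x) @ \oo --> iter k T x.
Proof.
move=> bT bTn Tn0; elim: k => [|k IH]; first exact: cvg_cst.
have [Tlin _] := bT; have [M M0 TM] := bounded_operator_pos bT.
apply/cvg_rnormP => e e0; pose B := rnorm (iter k T x) + 1.
have B0 : 0 < B by rewrite ltr_wpDl// rnorm_ge0.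
have eM : 0 < e / (2 * M) by rewrite divr_gt0// mulr_gt0.
have eB : 0 < e / (2 * B) by rewrite divr_gt0// mulr_gt0.
near=> n.
have H1 : rnorm (iter k T x - iter k (Tn n) x) < 1.
  by near: n; exact: ((cvg_rnormP _ _).1 IH).
have H2 : rnorm (iter k T x - iter k (Tn n) x) < e / (2 * M).
  by near: n; exact: ((cvg_rnormP _ _).1 IH).
have H3 : opnorm (Tn n \- T) < e / (2 * B).
  near: n; have /cvgrPdist_lt/(_ _ eB) := Tn0.
  apply: filterS => n; rewrite sub0r normrN; apply: le_lt_trans.
  exact: ler_norm.
have H4 : rnorm (iter k (Tn n) x) <= B.
  have := ler_rdistD (iter k T x) (iter k (Tn n) x) 0.
  by rewrite !subr0 rdistC /B; move: H1; lra.
rewrite !iterS (le_lt_trans (ler_rdistD (T (iter k (Tn n) x)) _ _))//.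
rewrite -(linear_funB Tlin) (rdistC _ (Tn n _)).
have := ler_opnorm (iter k (Tn n) x) (bounded_operatorB (bTn n) bT).
rewrite /= => H5; have H6 := TM (iter k T x - iter k (Tn n) x).
have H7 : M * rnorm (iter k T x - iter k (Tn n) x) < e / 2.
  move: H2; rewrite -(ltr_pM2l M0); congr (_ < _).
  by field; rewrite gt_eqF.
have H8 : opnorm (Tn n \- T) * rnorm (iter k (Tn n) x) <= e / 2.
  apply: (@le_trans _ _ (e / (2 * B) * B)); last first.
    by rewrite le_eqVlt; apply/orP; left; apply/eqP; field; rewrite gt_eqF.
  apply: (@le_trans _ _ (e / (2 * B) * rnorm (iter k (Tn n) x))).
    by rewrite ler_wpM2r ?rnorm_ge0// ltW.
  by rewrite ler_pM2l.
by lra.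
Unshelve. all: by end_near. Qed.

End OperatorNorm.

Section SpectralMeasure.
Context (R : realType) (X : completeNormedModType R[i]).
Context (P : set R[i] -> X -> X) (Pm : spectral_measure P).
Implicit Types (A B D : set R[i]) (x y : X).

Lemma spectral_measure_linear A : borel A -> linear (P A).
Proof. by move=> /(spectral_measure_bounded Pm)[]. Qed.

Lemma spectral_measure_set0 x : P set0 x = 0.
Proof. by rewrite (spectral_measure0 Pm). Qed.

Lemma spectral_measure_comp A B x : borel A -> borel B ->
  P A (P B x) = P (A `&` B) x.
Proof. by move=> bA bB; rewrite (spectral_measureI Pm). Qed.

Lemma spectral_measure_setC A x : borel A -> P (~` A) x = x - P A x.
Proof. by move=> bA; rewrite (spectral_measureC Pm). Qed.

Lemma spectral_measure_ubound : exists2 M : R, 0 < M &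
  forall A x, borel A -> rnorm (P A x) <= M * rnorm x.
Proof.
have [M PM] := spectral_measure_unif Pm.
exists (`|M| + 1); first by rewrite ltr_wpDl.
move=> A x bA.
rewrite (le_trans (ler_opnorm _ (spectral_measure_bounded Pm bA)))//.
rewrite ler_wpM2r ?rnorm_ge0// (@le_trans _ _ M)//.
  by apply: PM; exists A.
by rewrite (le_trans (ler_norm M))// lerDl.
Qed.

(** Binary additivity comes from the complement and product rules:
    [I - (I - P A) (I - P B) = P A + P B - P (A `&` B)]. *)
Lemma spectral_measureU A B x : borel A -> borel B -> A `&` B = set0 ->
  P (A `|` B) x = P A x + P B x.
Proof.
move=> bA bB AB0; have bA' := borelC bA; have bB' := borelC bB.
rewrite -[A `|` B]setCK setCU spectral_measure_setC; last exact: borelI.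
rewrite -spectral_measure_comp// !spectral_measure_setC//.
rewrite (linear_funB (spectral_measure_linear bA)) spectral_measure_comp//.
by rewrite AB0 spectral_measure_set0 subr0 opprB opprB addrC -addrA subrK.
Qed.

Lemma spectral_measure_sum (I : eqType) (s : seq I) (B : I -> set R[i]) x :
  uniq s -> (forall i, borel (B i)) ->
  (forall i j, i != j -> B i `&` B j = set0) ->
  \sum_(i <- s) P (B i) x = P (\big[setU/set0]_(i <- s) B i) x.
Proof.
move=> + bB Bd; elim: s => [_|i s IH /= /andP[is_ us]].
  by rewrite !big_nil spectral_measure_set0.
have bs : borel (\big[setU/set0]_(j <- s) B j).
  by elim/big_ind: _ => //; [exact: borel0|exact: borelU].
rewrite !big_cons IH// spectral_measureU//.
rewrite big_distrr/= big1_seq// => j /= js; apply: Bd.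
by apply: contraNneq is_ => ->.
Qed.

(** Countable additivity applied to the successive differences of the [A n],
    whose partial sums are the [P (A n) x]. *)
Lemma spectral_measure_cvg (A : nat -> set R[i]) x :
  (forall n, borel (A n)) -> nondecreasing_seq A ->
  (fun n => P (A n) x) @ \oo --> P (\bigcup_n A n) x.
Proof.
move=> bA Amono; have bD j : borel (seqD A j).
  by case: j => [|j] //=; exact: borelD.
have := @spectral_measure_sigma_additive _ _ _ Pm _ x bD (trivIset_seqD Amono).
rewrite eq_bigcup_seqD.
have -> : (fun n => P (A n) x) =
    (fun n => series (fun j => P (seqD A j) x) n.+1).
  apply/funext; elim=> [|n IH]; first by rewrite /series /= big_nat1.
  rewrite /series /= big_nat_recr//= [X in _ = X + _](esym IH).
  rewrite -spectral_measureU//; first last.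
    by rewrite setDE setIA setIAC setICr set0I.
    exact: borelD.
  by rewrite setDUK//; apply/subsetPset/Amono.
by rewrite cvg_shiftS.
Qed.

End SpectralMeasure.

(** * Integrals of simple functions *)

Section ConvexSums.
Context (R : realType) (V : normedModType R[i]) (I : eqType) (y : I -> V).

(** The sum is a convex function of each coefficient, so it is largest when all
    coefficients are [0] or [1].  The offset [a] carries the terms that are
    already decided through the induction. *)
Lemma rnorm_sum01 (s : seq I) (K : R) (c : I -> R) (a : V) :
  (forall t, subseq t s -> rnorm (a + \sum_(i <- t) y i) <= K) ->
  (forall i, i \in s -> 0 <= c i <= 1) ->
  rnorm (a + \sum_(i <- s) (c i)%:C *: y i) <= K.
Proof.
elim: s a => [|i s IH] a HK c01; first by have := HK [::] isT; rewrite !big_nil.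
have c01s j : j \in s -> 0 <= c j <= 1.
  by move=> js; apply: c01; rewrite inE js orbT.
have /andP[c0 c1] := c01 i (mem_head i s).
have H0 := IH a (fun t ts => HK t (subseq_trans ts (subseq_cons s i))) c01s.
have H1 : rnorm (a + y i + \sum_(j <- s) (c j)%:C *: y j) <= K.
  apply: IH c01s => t ts; have := HK (i :: t).
  by rewrite big_cons addrA /= eqxx; apply.
rewrite big_cons; set S := \sum_(j <- s) _ in H0 H1 *.
have -> : a + ((c i)%:C *: y i + S) =
    (c i)%:C *: (a + y i + S) + (1 - c i)%:C *: (a + S).
  rewrite rmorphB rmorph1 scalerBl scale1r [a + y i + S]addrAC scalerDr.
  by rewrite [RHS]addrC [RHS]addrA subrK addrA addrAC.
apply: le_trans (ler_rnormD _ _) _; rewrite !rnormZ !crnorm_real.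
rewrite !ger0_norm ?subr_ge0//.
have -> : K = c i * K + (1 - c i) * K by ring.
by rewrite lerD// ler_wpM2l ?subr_ge0.
Qed.

(** An affine change of variable sends [[-m, m]] to [[0, 1]]. *)
Lemma rnorm_real_sum (s : seq I) (K m : R) (c : I -> R) : 0 < m ->
  (forall t, subseq t s -> rnorm (\sum_(i <- t) y i) <= K) ->
  (forall i, i \in s -> `|c i| <= m) ->
  rnorm (\sum_(i <- s) (c i)%:C *: y i) <= 3 * K * m.
Proof.
move=> m0 HK cm; pose t i := (c i + m) / (2 * m).
have H : rnorm (0 + \sum_(i <- s) (t i)%:C *: y i) <= K.
  apply: rnorm_sum01 => [u us|i /cm]; first by rewrite add0r HK.
  rewrite ler_norml /t => /andP[c1 c2].
  by rewrite ler_pdivlMr ?ler_pdivrMr ?mulr_gt0//; lra.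
have -> : \sum_(i <- s) (c i)%:C *: y i =
    (2 * m)%:C *: (\sum_(i <- s) (t i)%:C *: y i) - m%:C *: \sum_(i <- s) y i.
  rewrite !scaler_sumr -sumrB; apply: eq_bigr => i _.
  rewrite scalerA -scalerBl -rmorphM -rmorphB; congr (_%:C *: _).
  by rewrite /t; field; rewrite gt_eqF.
apply: le_trans (ler_rnormB _ _) _; rewrite !rnormZ !crnorm_real.
rewrite !gtr0_norm ?mulr_gt0//.
rewrite add0r in H; have H2 := HK s (subseq_refl s).
have -> : 3 * K * m = 2 * m * K + m * K by ring.
by rewrite lerD// ler_pM2l ?mulr_gt0.
Qed.

Lemma rnorm_complex_sum (s : seq I) (K m : R) (c : I -> R[i]) : 0 < m ->
  (forall t, subseq t s -> rnorm (\sum_(i <- t) y i) <= K) ->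
  (forall i, i \in s -> rnorm (c i) <= m) ->
  rnorm (\sum_(i <- s) c i *: y i) <= 6 * K * m.
Proof.
move=> m0 HK cm.
have -> : \sum_(i <- s) c i *: y i =
    \sum_(i <- s) (complex.Re (c i))%:C *: y i +
    'i *: \sum_(i <- s) (complex.Im (c i))%:C *: y i.
  rewrite scaler_sumr -big_split/=; apply: eq_bigr => i _.
  by rewrite scalerA -scalerDl -complexE.
apply: le_trans (ler_rnormD _ _) _; rewrite rnormZ rnorm_i mul1r.
have -> : 6 * K * m = 3 * K * m + 3 * K * m by ring.
by apply: lerD; apply: rnorm_real_sum => // i /cm; apply: le_trans;
  [exact: normRe_le|exact: normIm_le].
Qed.

End ConvexSums.

Section SimpleIntegral.
Context (R : realType) (X : completeNormedModType R[i]).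
Context (P : set R[i] -> X -> X) (Pm : spectral_measure P).
Context (D : set R[i]) (bD : borel D) (s : R[i] -> R[i]).
Context (ss : simple_function s).

Let V : seq R[i] := finmap.enum_fset (fset_set (range s)).
Let B v := D `&` s @^-1` [set v].

Let bB v : borel (B v).
Proof. by apply: borelI => //; have [_] := ss. Qed.

Let Bdisj v w : v != w -> B v `&` B w = set0.
Proof.
move=> vw; apply/seteqP; split=> // l [[_ /= lv] [_ /= lw]].
by move: vw; rewrite -lv -lw eqxx.
Qed.

Let V_uniq : uniq V. Proof. exact: finmap.fset_uniq. Qed.

Lemma simple_integralE x :
  simple_integral P D s x = \sum_(v <- V) v *: P (B v) x.
Proof. by rewrite /simple_integral fsbig_finite//; case: ss. Qed.

(** A bound independent of the number of values of [s]: every partial sum of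
    the vectors [P (B v) x] is [P] of a Borel set applied to [x].  Values [v]
    that are not attained on [D] contribute nothing, so [c v] is unconstrained
    there. *)
Lemma rnorm_simple_sum (M m : R) (c : R[i] -> R[i]) x :
  (forall A u, borel A -> rnorm (P A u) <= M * rnorm u) ->
  0 < m -> (forall v, B v !=set0 -> rnorm (c v) <= m) ->
  rnorm (\sum_(v <- V) c v *: P (B v) x) <= 6 * (M * rnorm x) * m.
Proof.
move=> PM m0 cm.
(* Off the nonempty level sets the coefficient is reset to 0, so that it is
   bounded by m everywhere. *)
pose c' v := if `[< B v !=set0 >] then c v else 0.
have -> : \sum_(v <- V) c v *: P (B v) x = \sum_(v <- V) c' v *: P (B v) x.
  apply: eq_bigr => v _; rewrite /c'; case: asboolP => // /nonemptyPn ->.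
  by rewrite (spectral_measure_set0 Pm) !scaler0.
apply: rnorm_complex_sum => // [t tV|v _]; last first.
  by rewrite /c'; case: asboolP => [/cm//|_]; rewrite rnorm0 ltW.
rewrite (spectral_measure_sum Pm)//; last exact: subseq_uniq V_uniq.
apply: PM; elim/big_ind: _ => //; [exact: borel0|exact: borelU].
Qed.

(** The integral is multiplicative because the level sets [B v] are pairwise
    disjoint.  The exponent must be positive: the zeroth power is the identity,
    whereas the integral of [1] is [P D]. *)
Lemma iter_simple_integral k x :
  iter k.+1 (simple_integral P D s) x = \sum_(v <- V) v ^+ k.+1 *: P (B v) x.
Proof.
elim: k => [|k IH]; first exact: simple_integralE.
rewrite iterS IH simple_integralE; apply: eq_big_seq => v vV.
rewrite (linear_fun_sum (spectral_measure_linear Pm (bB v))).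
rewrite (bigD1_seq v)//= big1 => [|w wv]; rewrite ?addr0;
  rewrite (linear_funZ (spectral_measure_linear Pm (bB v)));
  rewrite (spectral_measure_comp Pm)//.
  by rewrite setIid scalerA -exprS.
by rewrite Bdisj 1?eq_sym// (spectral_measure_set0 Pm) scaler0.
Qed.

Lemma bounded_simple_integral : bounded_operator (simple_integral P D s).
Proof.
have [M M0 PM] := spectral_measure_ubound Pm; split.
  move=> a x y; rewrite !simple_integralE scaler_sumr -big_split.
  apply: eq_bigr => v _ /=; rewrite (spectral_measure_linear Pm (bB v)).
  by rewrite scalerDr !scalerA mulrC.
exists ((\sum_(v <- V) rnorm v) * M) => x _.
rewrite simple_integralE (le_trans (ler_rnorm_sum _ _))// !mulr_suml.
by apply: ler_sum => v _; rewrite rnormZ -mulrA ler_wpM2l ?rnorm_ge0// PM.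
Qed.

Lemma simple_integral_set1 z x :
  simple_integral P D s (P [set z] x) = s z *: P (D `&` [set z]) x.
Proof.
have b1 := borel_set1 z.
have zV : s z \in V.
  by rewrite in_fset_set ?mem_setE; [apply/mem_set; exists z|case: ss].
rewrite simple_integralE (bigD1_seq (s z))//= big1 => [|v vz].
  rewrite addr0 (spectral_measure_comp Pm)//; congr (_ *: P _ x).
  by apply/seteqP; split=> l /= [] => [[Dl _]|Dl] lz; rewrite ?lz in Dl *.
rewrite (spectral_measure_comp Pm)// (_ : _ `&` _ = set0).
  by rewrite (spectral_measure_set0 Pm) scaler0.
apply/seteqP; split=> // l [[_ /= lv] /= lz].
by move: vz; rewrite -lv lz eqxx.
Qed.

End SimpleIntegral.

(** * Scalar type operators *)

Section ScalarType.
Context (R : realType) (X : completeNormedModType R[i]).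
Context (P : set R[i] -> X -> X) (S : X -> X) (SP : scalar_type P S).

Let Pm : spectral_measure P. Proof. by case: SP => _ []. Qed.
Let bS : bounded_operator S. Proof. by case: SP. Qed.
Let bD : borel (spectrum S). Proof. exact: borel_spectrum. Qed.

(** The simple functions approximating the identity on the spectrum are
    eventually bounded by [r + d] there, for each [d > 0]; the bound with [r]
    itself follows as [d] tends to [0]. *)
Lemma scalar_type_power_bounded (r : R) : 0 < r ->
  (forall l, spectrum S l -> rnorm l <= r) ->
  exists2 C : R, 0 < C & forall k x, rnorm (iter k S x) <= C * r ^+ k * rnorm x.
Proof.
move=> r0 Sr; have [M M0 PM] := spectral_measure_ubound Pm.
have [_ _ [s [ss s_id s_S]]] := SP.
exists (6 * M + 1); first by rewrite ltr_wpDl// mulr_ge0// ltW.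
move=> [|k] x.
  by rewrite expr0 mulr1 ler_peMl ?rnorm_ge0// lerDr mulr_ge0// ltW.
have bnd (d : R) : 0 < d ->
    rnorm (iter k.+1 S x) <= 6 * (M * rnorm x) * (r + d) ^+ k.+1.
  move=> d0; apply/ler_addgt0Pl => e e0.
  have cS := @cvg_iter_opnorm _ _ _ _ k.+1 x bS
    (fun n => bounded_simple_integral Pm bD (ss n)) s_S.
  near \oo => n.
  have H1 : rnorm (iter k.+1 S x -
      iter k.+1 (simple_integral P (spectrum S) (s n)) x) < e.
    by near: n; exact: ((cvg_rnormP _ _).1 cS).
  have H2 : forall v, spectrum S v -> rnorm (v - s n v) < d.
    by near: n; exact: (uniform_cvg_rnorm s_id d0).
  have := ler_rdistD (iter k.+1 (simple_integral P (spectrum S) (s n)) x)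
    (iter k.+1 S x) 0.
  rewrite !subr0 => /le_trans; apply; apply: lerD; first exact: ltW.
  rewrite (iter_simple_integral Pm bD (ss n)).
  apply: rnorm_simple_sum => //; first by rewrite exprn_gt0// addr_gt0.
  move=> v [l [Dl <-]]; rewrite crnormX lerXn2r ?nnegrE ?rnorm_ge0//.
    by rewrite addr_ge0// ltW.
  have := ler_rdistD l (s n l) 0; rewrite !subr0 rdistC.
  by have := Sr _ Dl; have := H2 _ Dl; lra.
apply: (@le_trans _ _ (6 * (M * rnorm x) * r ^+ k.+1)); last first.
  have := mulr_ge0 (exprn_ge0 k.+1 (ltW r0)) (rnorm_ge0 x); lra.
have cr : (fun n : nat => 6 * (M * rnorm x) * (r + n.+1%:R^-1) ^+ k.+1) @ \oo
    --> 6 * (M * rnorm x) * r ^+ k.+1.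
  have rn : (fun n : nat => r + n.+1%:R^-1) @ \oo --> r.
    rewrite -[X in _ --> X]addr0; apply: cvgD; first exact: cvg_cst.
    exact: cvg_harmonic.
  apply: cvgMr; exact: (cvg_comp _ _ rn (@exprn_continuous _ k.+1 r)).
apply: (ler_cvg_to (cvg_cst _) cr).
by near=> n; apply: bnd; rewrite invr_gt0.
Unshelve. all: by end_near. Qed.

(** On the range of [P [set z]] the only level set of [s n] that counts is the
    one containing [z], so the simple integral acts there as the scalar [s n z],
    which tends to [z] when [z] is in the spectrum. *)
Lemma scalar_type_set1 z x :
  S (P [set z] x) = z *: P (spectrum S `&` [set z]) x.
Proof.
have [_ _ [s [ss s_id s_S]]] := SP.
have cS : (fun n => s n z *: P (spectrum S `&` [set z]) x) @ \oo -->
    S (P [set z] x).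
  have -> : (fun n => s n z *: P (spectrum S `&` [set z]) x) =
      (fun n => iter 1 (simple_integral P (spectrum S) (s n)) (P [set z] x)).
    by apply/funext => n /=; rewrite (simple_integral_set1 Pm bD (ss n)).
  apply: (cvg_iter_opnorm bS _ s_S) => n.
  exact: (bounded_simple_integral Pm bD (ss n)).
apply: (cvg_unique (@norm_hausdorff _ X) cS).
have [Dz|Dz] := pselect (spectrum S z); last first.
  rewrite (_ : _ `&` _ = set0) ?(spectral_measure_set0 Pm) ?scaler0.
    have -> : (fun n => s n z *: (0 : X)) = cst 0.
      by apply/funext => n; rewrite scaler0.
    exact: cvg_cst.
  by apply/seteqP; split=> // l /= [+ lz]; rewrite lz.
apply: cvgZl; apply/cvgrPdist_lt => e; rewrite ltcE => /andP[/eqP Ime Ree].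
have := uniform_cvg_rnorm s_id Ree; apply: filterS => n /(_ _ Dz).
by rewrite rnormE ltcE Ime eqxx.
Qed.

(** If [z] misses the spectrum then [S] vanishes on the range of [P [set z]],
    while [0] lies outside the closure of [[set z]]: the zero operator is then
    invertible on that range, which must be trivial. *)
Lemma scalar_type_eigen z x : z != 0 -> S (P [set z] x) = z *: P [set z] x.
Proof.
move=> z0; have [Dz|Dz] := pselect (spectrum S z).
  rewrite scalar_type_set1; congr (_ *: P _ x).
  by apply/setIidPr => l /= ->.
have b1 := borel_set1 z; have [_ [_ _ /(_ _ b1) Pcl] _] := SP.
have S0 u : S (P [set z] u) = 0.
  rewrite scalar_type_set1 (_ : _ `&` _ = set0).
    by rewrite (spectral_measure_set0 Pm) scaler0.
  by apply/seteqP; split=> // l /= [+ lz]; rewrite lz.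
have [U [UY Ulin _ UT _]] : resolvent_on (range (P [set z])) S 0.
  apply: contrapT => /Pcl; apply: (not_closure_rnorm (r := rnorm z)).
    by rewrite rnorm_gt0.
  by move=> b ->; rewrite rdistC subr0.
have P0 u : P [set z] u = U 0.
  by rewrite -(UT (P [set z] u)) ?S0 ?scale0r ?subr0//; exists u.
by rewrite S0 P0 -(P0 0) (linear_fun0 (spectral_measure_linear Pm b1)) scaler0.
Qed.

End ScalarType.

(** * The mean ergodic theorem *)

Section Averages.
Context (R : realType) (X : completeNormedModType R[i]).
Context (S : X -> X) (Slin : linear S) (z : R[i]) (z0 : z != 0) (C : R).
Context (SC : forall k x, rnorm (iter k S x) <= C * rnorm z ^+ k * rnorm x).

Definition ergodic_average (n : nat) (x : X) : X :=
  n%:R^-1 *: \sum_(1 <= k < n.+1) z ^- k *: iter k S x.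

Let iter_linear k : linear (iter k S).
Proof. by elim: k => [//|k IH] a u v; rewrite !iterS IH Slin. Qed.

Lemma ergodic_averageD n u v :
  ergodic_average n (u + v) = ergodic_average n u + ergodic_average n v.
Proof.
rewrite -scalerDr -big_split; congr (_ *: _); apply: eq_bigr => k _ /=.
by rewrite (linear_funD (iter_linear k)) scalerDr.
Qed.

Let rnorm_term k x : rnorm (z ^- k *: iter k S x) <= C * rnorm x.
Proof.
have zk : 0 < rnorm z ^+ k by rewrite exprn_gt0// rnorm_gt0.
by rewrite rnormZ crnormV crnormX mulrC ler_pdivrMr// mulrAC.
Qed.

Lemma rnorm_ergodic_average n x : rnorm (ergodic_average n x) <= C * rnorm x.
Proof.
case: n => [|n].
  rewrite /ergodic_average big_geq// scaler0 rnorm0.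
  exact: le_trans (rnorm_ge0 _) (rnorm_term 0 x).
rewrite rnormZ crnormV crnorm_nat mulrC ler_pdivrMr//.
apply: le_trans (ler_rnorm_sum _ _) _.
apply: le_trans (ler_sum _ (fun k _ => rnorm_term k x)) _.
by rewrite sumr_const_nat subn1 mulr_natr.
Qed.

(** The index starts at [n.+1] because the average over zero terms is [0]. *)
Lemma ergodic_average_eigen n x : S x = z *: x ->
  ergodic_average n.+1 x = x.
Proof.
move=> Sx; have E k : z ^- k *: iter k S x = x.
  elim: k => [|k IH]; first by rewrite expr0 invr1 scale1r.
  rewrite iterSr Sx (linear_funZ (iter_linear k)) scalerA exprS invfM mulrC.
  by rewrite mulrA divff// mul1r.
rewrite /ergodic_average; under eq_bigr do rewrite E.
by rewrite sumr_const_nat subn1 -(scaler_nat _ x) scalerA mulVf ?scale1r//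
  pnatr_eq0.
Qed.

(** The [k]-th term is the difference of consecutive values of the bounded
    sequence [z * z^-k S^k u], so the sum telescopes to a bounded quantity. *)
Lemma ergodic_average_coboundary u :
  (fun n => ergodic_average n (S u - z *: u)) @ \oo --> (0 : X).
Proof.
pose f k := z *: (z ^- k *: iter k S u).
have E n : ergodic_average n (S u - z *: u) = n%:R^-1 *: (f n.+1 - f 1).
  rewrite /ergodic_average; congr (_ *: _); rewrite -telescope_sumr//.
  apply: eq_bigr => k _; rewrite (linear_funB (iter_linear k)).
  rewrite (linear_funZ (iter_linear k)) -iterSr scalerBr /f !scalerA.
  rewrite [z * z ^- k]mulrC exprS invfM [in RHS]mulrA divff// mul1r.
  by [].
have fC k : rnorm (f k) <= rnorm z * (C * rnorm u).
  by rewrite rnormZ ler_wpM2l ?rnorm_ge0.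
pose K := rnorm z * (C * rnorm u) + rnorm z * (C * rnorm u).
have K0 : 0 <= K by rewrite addr_ge0// (le_trans (rnorm_ge0 (f 0)) (fC 0)).
apply/cvg_rnormP => e e0.
exists (Num.trunc (K / e)).+1 => // n /= Kn.
have n0 : (0 : R) < n%:R by rewrite ltr0n (leq_trans _ Kn).
rewrite sub0r rnormN E rnormZ crnormV crnorm_nat mulrC ltr_pdivrMr//.
apply: le_lt_trans (ler_rnormB _ _) _.
apply: le_lt_trans (lerD (fC _) (fC _)) _.
rewrite -/K [e * _]mulrC -ltr_pdivrMr//; apply: lt_le_trans (truncnS_gt _) _.
by rewrite ler_nat.
Qed.

End Averages.

Theorem proposition5p1 (R : realType) (X : completeNormedModType R[i])
    (S : X -> X) (E : set R[i] -> X -> X) (z : R[i]) :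
  scalar_type E S ->
  0 < spectral_radius S ->
  rnorm z = sup [set rnorm l | l in spectrum S] ->
  forall x : X,
    (fun n : nat => n%:R^-1 *: \sum_(1 <= k < n.+1) z ^- k *: iter k S x)
      @ \oo --> E [set z] x.
Proof.
move=> SE rho0 zE x.
have rz0 : 0 < rnorm z by rewrite zE.
have z0 : z != 0 by rewrite -rnorm_gt0.
have [[Slin _] [Em _ Ecl] _] := SE.
have Sz l : spectrum S l -> rnorm l <= rnorm z.
  move=> Sl; rewrite zE; apply: ub_le_sup; last by exists l.
  have [[]//|nsup] := pselect (has_sup [set rnorm l | l in spectrum S]).
  by move: rho0; rewrite /spectral_radius sup_out// ltxx.
have [C C0 SC] := scalar_type_power_bounded SE rz0 Sz.
pose A n := [set l : R[i] | n.+1%:R^-1 <= rnorm (z - l)].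
have bA n : borel (A n) by exact: borel_far.
have b1 := borel_set1 z.
have Amono : nondecreasing_seq A.
  move=> m n mn; apply/subsetPset => l; apply: le_trans.
  by rewrite lef_pV2 ?posrE// ler_nat.
(* A point l <> z lies in A n as soon as n + 1 exceeds 1 / |z - l|. *)
have Acup : \bigcup_n A n = ~` [set z].
  apply/seteqP; split=> [l [n _ /= Anl] /= lz|l /= lz].
    by move: Anl; rewrite /A /= lz subrr rnorm0 leNgt invr_gt0 ltr0Sn.
  have zl : 0 < rnorm (z - l).
    by rewrite rnorm_gt0 subr_eq0; apply/eqP => zl; apply: lz.
  exists (Num.trunc (rnorm (z - l))^-1) => //=.
  by rewrite /A /= -[leRHS]invrK lef_pV2 ?posrE ?invr_gt0// ltW// truncnS_gt.
have EA : (fun n => E (A n) x) @ \oo --> x - E [set z] x.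
  rewrite -(spectral_measure_setC Em)// -Acup.
  exact: spectral_measure_cvg.
have avgA n : (fun k => ergodic_average S z k (E (A n) x)) @ \oo --> (0 : X).
  have [U [UY _ _ _ SU]] : resolvent_on (range (E (A n))) S z.
    apply: contrapT => /(Ecl _ (bA n)).
    by apply: (not_closure_rnorm (r := n.+1%:R^-1)); rewrite ?invr_gt0.
  rewrite -(SU (E (A n) x)); last by exists x.
  exact: (ergodic_average_coboundary Slin z0 SC).
apply/cvg_rnormP => e e0.
have e1 : 0 < e / (2 * C) by rewrite divr_gt0// mulr_gt0.
have e2 : 0 < e / 2 by rewrite divr_gt0.
have [N _ /(_ N (leqnn N)) HN] := (cvg_rnormP _ _).1 EA _ e1.
have [n0 _ Hn0] := (cvg_rnormP _ _).1 (avgA N) _ e2.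
exists n0.+1 => // -[//|n] /= n0n.
have := Hn0 n.+1 (leqW n0n); rewrite /= sub0r rnormN => H1.
have H2 := rnorm_ergodic_average z0 SC n.+1 (x - E [set z] x - E (A N) x).
have H3 : C * rnorm (x - E [set z] x - E (A N) x) < e / 2.
  by move: HN; rewrite -(ltr_pM2l C0); congr (_ < _); field; rewrite gt_eqF.
rewrite -/(ergodic_average S z n.+1 x).
have {2}-> : x = E [set z] x + (E (A N) x + (x - E [set z] x - E (A N) x)).
  by rewrite [_ + (_ - E (A N) x)]addrC subrK addrC subrK.
rewrite 2!(ergodic_averageD Slin) ergodic_average_eigen//; last first.
  exact: scalar_type_eigen.
rewrite opprD addrA subrr add0r rnormN.
apply: le_lt_trans (ler_rnormD _ _) _.
by rewrite (splitr e) ltrD// (le_lt_trans H2).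
Qed.
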